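(* Let $s>0$ and $c\ge 0$. Then the structure $\bigl(\overline{\mathbb R},\,(xW_s'/W_s)'{\restriction}(c,\infty)\bigr)$ defines the power function $x\mapsto x^s\colon(0,\infty)\to\mathbb R$. If moreover $1/s\in\mathbb N$, then $\bigl(\overline{\mathbb R},\,(xW_s'/W_s)'{\restriction}(c,\infty)\bigr)$ defines the exponential function $x\mapsto e^x\colon\mathbb R\to\mathbb R$.
   Context: $\overline{\mathbb R}=(\mathbb R,+,\cdot,(r)_{r\in\mathbb R})$ is the real field with a constant for each real number. An expansion of $\overline{\mathbb R}$ by a function (or set) is the structure obtained by adding it as a new primitive; ''defines'' means first-order definable (parameters from $\mathbb R$ allowed), where a partial function is identified with its graph. $\mathbb N$ is the set of nonnegative integers. For $s>0$, $W_s$ is the canonical Weierstrass product for the sequence $(-n^s)_{n>0}$: $$W_s(z)=\prod_{n>0}\left(1+\frac{z}{n^s}\right)\exp\left(\sum_{j=1}^{\lfloor 1/s\rfloor}\frac{(-1)^jz^j}{jn^{sj}}\right),\quad z\in\mathbb C,$$ an entire function, real on the real line. Here $W_s$ is regarded as a function on $(0,\infty)$ (where it is positive), and $(xW_s'/W_s)'$ is the function $x\mapsto \frac{d}{dx}\bigl(xW_s'(x)/W_s(x)\bigr)$. *)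

(* Defs.v *)
From Stdlib Require Import Reals.
From Coquelicot Require Import Coquelicot.

Open Scope R_scope.

(** * First-order definability in an expansion of the real field *)

(** Terms and formulas of the language of rings with a constant for each real
    number and one additional binary relation symbol.  Variables are de Bruijn
    indices: a quantifier binds index [0] and shifts the others. *)

Inductive term : Type :=
  | Var (i : nat)
  | Const (r : R)
  | Add (t u : term)
  | Mul (t u : term).

Inductive formula : Type :=
  | Eq (t u : term)
  | Rel (t u : term)
  | Not (p : formula)
  | And (p q : formula)
  | Or (p q : formula)
  | Ex (p : formula)
  | All (p : formula).

Fixpoint eval (v : nat -> R) (t : term) : R :=
  match t with
  | Var i => v i
  | Const r => r
  | Add t u => eval v t + eval v u
  | Mul t u => eval v t * eval v u
  end.

Definition scons (a : R) (v : nat -> R) (i : nat) : R :=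
  match i with O => a | S j => v j end.

(** Satisfaction in the expansion of the real field by [P]. *)
Fixpoint sat (P : R -> R -> Prop) (v : nat -> R) (p : formula) : Prop :=
  match p with
  | Eq t u => eval v t = eval v u
  | Rel t u => P (eval v t) (eval v u)
  | Not p => ~ sat P v p
  | And p q => sat P v p /\ sat P v q
  | Or p q => sat P v p \/ sat P v q
  | Ex p => exists a : R, sat P (scons a v) p
  | All p => forall a : R, sat P (scons a v) p
  end.

(** Parameters are available as constants.  Quantifying over all valuations
    makes the free variables other than [0] and [1] irrelevant. *)
Definition defines (P Q : R -> R -> Prop) : Prop :=
  exists p : formula, forall v : nat -> R, sat P v p <-> Q (v 0%nat) (v 1%nat).

(** The graph of the restriction of [f] to [D]. *)
Definition graph (D : R -> Prop) (f : R -> R) (x y : R) : Prop :=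
  D x /\ y = f x.

(** * The Weierstrass product *)

Definition Cexp (z : C) : C :=
  (exp (Re z) * cos (Im z), exp (Re z) * sin (Im z)).

(** [Int_part] is the floor function, and [sum_n_m] is an empty sum when the
    upper bound is [0]. *)
Definition weierstrass_factor (s : R) (n : nat) (z : C) : C :=
  ((1 + z / RtoC (Rpower (INR n) s)) *
   Cexp (sum_n_m
     (fun j : nat =>
        (RtoC ((-1) ^ j) * Cpow z j)
        / RtoC (INR j * Rpower (INR n) (s * INR j)))
     1 (Z.to_nat (Int_part (1 / s)))))%C.

Fixpoint weierstrass_partial (s : R) (N : nat) (z : C) : C :=
  match N with
  | O => RtoC 1
  | S m => (weierstrass_partial s m z * weierstrass_factor s (S m) z)%C
  end.

Definition weierstrass (s : R) (z : C) : C :=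
  (real (Lim_seq (fun N => Re (weierstrass_partial s N z))),
   real (Lim_seq (fun N => Im (weierstrass_partial s N z)))).

(** [W_s] as a real function; it is real on the real line. *)
Definition W (s : R) (x : R) : R := Re (weierstrass s (RtoC x)).

Definition dxlogW (s : R) : R -> R :=
  Derive (fun x => x * Derive (W s) x / W s x).

(* Main.v *)
(** Logarithmic differentiation gives, with [a_n = (n + 1)^-s],
    [k = floor (1/s)] and [w = u / (1 + u)],
    [x * dxlogW s x = (-1)^k * sum_n h (a_n x)], where
    [h u = (k + 1) u^k w - u^k w^2].  Substituting [x = y^s] turns
    [sum_n h (a_n x) / y] into a Riemann sum of [v |-> h (v^-s)] on [(0, oo)]
    with step [1/y].  If [k < 1/s], it has a positive limit, so
    [f = dxlogW s] is equivalent to a multiple of [x^(1/s - 1)], and [y = x^s]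
    holds iff [f (t y) / f t] tends to [x / y] as [t] tends to infinity.
    If [k = 1/s], then [x^s] is algebraic, while the integral diverges
    logarithmically: [F = (-1)^k f / x^(k-1)] satisfies [x F' x -> L > 0] by the
    same Riemann sum argument, hence [F (t y) - F t -> L ln y], which makes [ln]
    definable.

    The convergence of the Riemann sums needs no integral: for a decreasing
    function, [U y = sum_n phi ((n + 1) / y)] satisfies [m U y <= U (m y)] for
    integers [m], which together with [U y <= K y] forces [U y / y] to converge
    to its supremum. *)

Require Import Defs.
From Stdlib Require Import Reals Lra Lia.
From Coquelicot Require Import Coquelicot.
(* Coquelicot's [AutoDerive] also has a constructor [Var]. *)
Import Defs.
Open Scope R_scope.

(** * Partial sums and convergence of real series *)

(** The sum over the indices [n < N], so that [psum a 0] is the empty sum; [sum_n a n] includes the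
    index [n]. *)
Fixpoint psum (a : nat -> R) (N : nat) : R :=
  match N with O => 0 | S n => psum a n + a n end.

Lemma sum_n_psum a n : sum_n a n = psum a (S n).
Proof.
  induction n as [|n IH].
  - rewrite sum_O. simpl. symmetry. apply Rplus_0_l.
  - rewrite sum_Sn, IH. reflexivity.
Qed.

Lemma is_series_psum a (l : R) : is_series a l <-> is_lim_seq (psum a) l.
Proof.
  rewrite (is_lim_seq_incr_1 (psum a)). split; intro H.
  - apply is_lim_seq_ext with (sum_n a); [intro; apply sum_n_psum | exact H].
  - apply (is_lim_seq_ext _ (sum_n a)) in H; [exact H |].
    intro; symmetry; apply sum_n_psum.
Qed.

Lemma is_lim_seq_psum a : ex_series a -> is_lim_seq (psum a) (Series a).
Proof. intro H. apply is_series_psum, Series_correct, H. Qed.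

Lemma psum_ext a b N : (forall n, (n < N)%nat -> a n = b n) -> psum a N = psum b N.
Proof.
  induction N as [|N IH]; intro H; [reflexivity|].
  simpl. rewrite IH, (H N); [reflexivity | lia | intros; apply H; lia].
Qed.

Lemma psum_le_psum a N M :
  (forall n, 0 <= a n) -> (N <= M)%nat -> psum a N <= psum a M.
Proof.
  intros Ha HNM. induction HNM as [|M _ IH]; [lra|].
  simpl. specialize (Ha M). lra.
Qed.

Lemma psum_scal c a N : psum (fun n => c * a n) N = c * psum a N.
Proof. induction N as [|N IH]; simpl; [ring | rewrite IH; ring]. Qed.

Lemma psum_le_Series a N :
  (forall n, 0 <= a n) -> ex_series a -> psum a N <= Series a.
Proof.
  intros Ha He. apply (is_lim_seq_incr_compare (psum a)).
  - apply is_lim_seq_psum, He.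
  - intro n. simpl. specialize (Ha n). lra.
Qed.

Lemma Series_le_bound a B :
  ex_series a -> (forall N, psum a N <= B) -> Series a <= B.
Proof.
  intros He HB.
  apply (is_lim_seq_le (psum a) (fun _ => B) (Series a) B HB).
  - apply is_lim_seq_psum, He.
  - apply is_lim_seq_const.
Qed.

Lemma ex_series_bounded a B :
  (forall n, 0 <= a n) -> (forall N, psum a N <= B) -> ex_series a.
Proof.
  intros Ha HB. destruct (ex_finite_lim_seq_incr (psum a) B) as [l Hl].
  - intro n. simpl. specialize (Ha n). lra.
  - exact HB.
  - exists l. apply is_series_psum, Hl.
Qed.

Lemma ex_series_dominated (a b : nat -> R) :
  (forall n, Rabs (a n) <= b n) -> ex_series b -> ex_series a.
Proof. intros H. apply (ex_series_le a b). exact H. Qed.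

Lemma ex_series_Rmult (c : R) a : ex_series a -> ex_series (fun n => c * a n).
Proof. exact (ex_series_scal_l c a). Qed.

(** * Differentiation of series *)

Lemma psum_tail_bound q M N P :
  (forall n, Rabs (q n) <= M n) -> (N <= P)%nat ->
  Rabs (psum q P) <= Rabs (psum q N) + (psum M P - psum M N).
Proof.
  intros H HNP. induction HNP as [|P _ IH]; [lra|].
  simpl. pose proof (Rabs_triang (psum q P) (q P)). specialize (H P). lra.
Qed.

(** The first [N] terms are kept exactly and only the rest is replaced by the majorant, so that
    differentiating a series reduces to differentiating a finite sum. *)
Lemma Series_tail_bound q M N :
  (forall n, Rabs (q n) <= M n) -> ex_series M ->
  Rabs (Series q) <= Rabs (psum q N) + (Series M - psum M N).
Proof.
  intros H HM.
  assert (Hq : ex_series q) by (apply ex_series_dominated with M; assumption).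
  pose proof (is_lim_seq_psum _ Hq) as Lq. pose proof (is_lim_seq_psum _ HM) as LM.
  apply is_lim_seq_abs in Lq.
  apply (is_lim_seq_incr_n _ N) in Lq. apply (is_lim_seq_incr_n _ N) in LM.
  apply (is_lim_seq_le _ (fun n => Rabs (psum q N) + (psum M (n + N) - psum M N))
    _ (Rabs (psum q N) + (Series M - psum M N))%R) in Lq.
  - exact Lq.
  - intro n. apply psum_tail_bound; [exact H | lia].
  - apply is_lim_seq_plus'; [apply is_lim_seq_const|].
    apply is_lim_seq_minus'; [exact LM | apply is_lim_seq_const].
Qed.

Lemma is_derive_psum (f f' : nat -> R -> R) x N :
  (forall n, is_derive (f n) x (f' n x)) ->
  is_derive (fun y => psum (fun n => f n y) N) x (psum (fun n => f' n x) N).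
Proof.
  intro H. induction N as [|N IH]; simpl.
  - apply (is_derive_const 0).
  - apply (is_derive_plus (fun y => psum (fun n => f n y) N) (f N)); auto.
Qed.

Lemma psum_minus a b N : psum (fun n => a n - b n) N = psum a N - psum b N.
Proof. induction N as [|N IH]; simpl; [ring | rewrite IH; ring]. Qed.

Lemma derive_increment_bound (f f' : R -> R) x d M y :
  (forall z, Rabs (z - x) < d -> is_derive f z (f' z) /\ Rabs (f' z) <= M) ->
  Rabs (y - x) < d -> Rabs (f y - f x) <= M * Rabs (y - x).
Proof.
  intros H Hy.
  assert (Hb : forall z, Rmin x y <= z <= Rmax x y -> Rabs (z - x) < d).
  { intros z Hz. apply Rle_lt_trans with (2 := Hy). revert Hz.
    unfold Rmin, Rmax. destruct (Rle_dec x y);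
    intros; unfold Rabs; destruct (Rcase_abs (z - x)), (Rcase_abs (y - x)); lra. }
  destruct (MVT_gen f x y f') as (c & Hc & E).
  - intros z Hz. apply H, Hb. lra.
  - intros z Hz. apply continuity_pt_filterlim, (ex_derive_continuous f).
    exists (f' z). apply H, Hb, Hz.
  - rewrite E, Rabs_mult. apply Rmult_le_compat_r; [apply Rabs_pos|].
    apply H, Hb, Hc.
Qed.

(** By the mean value inequality, each difference quotient minus its derivative is at most [2 * M n]
    in absolute value. The first [N] terms are differentiated as a finite sum, and the remaining
    ones are small uniformly in [h]. *)
Lemma is_derive_Series (f f' : nat -> R -> R) (M : nat -> R) x d :
  0 < d ->
  (forall n y, Rabs (y - x) < d ->
     is_derive (f n) y (f' n y) /\ Rabs (f' n y) <= M n) ->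
  ex_series M -> ex_series (fun n => f n x) ->
  is_derive (fun y => Series (fun n => f n y)) x (Series (fun n => f' n x)).
Proof.
  intros Hd Hf HM Hx.
  assert (Hxx : Rabs (x - x) < d) by (rewrite Rminus_diag, Rabs_R0; exact Hd).
  assert (Hf' : ex_series (fun n => f' n x)).
  { apply ex_series_dominated with M; [|exact HM]. intro n. apply Hf, Hxx. }
  assert (Hi : forall n y, Rabs (y - x) < d ->
             Rabs (f n y - f n x) <= M n * Rabs (y - x)).
  { intros n y. apply derive_increment_bound with (f' n). apply Hf. }
  assert (Hy : forall y, Rabs (y - x) < d -> ex_series (fun n => f n y)).
  { intros y Hyd. apply ex_series_ext with (fun n => (f n y - f n x) + f n x).
    - intro n. change (f n y - f n x + f n x = f n y). ring.
    - apply (ex_series_plus (fun n => f n y - f n x)); [|exact Hx].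
      apply ex_series_dominated with (fun n => M n * Rabs (y - x)).
      + intro n. apply Hi, Hyd.
      + apply ex_series_scal_r, HM. }
  apply is_derive_Reals. intros eps Heps.
  (* The tail enters with the factor 2 of [2 * M n], so [eps / 4] leaves [eps / 2] for the first [N]
     terms. *)
  assert (HN : exists N, Series M - psum M N < eps / 4).
  { pose proof (is_lim_seq_psum _ HM) as L. apply is_lim_seq_spec in L.
    assert (He : 0 < eps / 4) by lra.
    destruct (L (mkposreal _ He)) as [N HN]. exists N.
    specialize (HN N (le_n _)). simpl in HN.
    apply Rabs_def2 in HN. lra. }
  destruct HN as [N HN].
  assert (Hp : is_derive (fun y => psum (fun n => f n y) N) x
                 (psum (fun n => f' n x) N)).
  { apply is_derive_psum. intro n. apply Hf, Hxx. }
  apply is_derive_Reals in Hp. destruct (Hp (eps / 2)) as [r Hr]; [lra|].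
  assert (Hm : 0 < Rmin r d) by (apply Rmin_pos; [apply cond_pos | exact Hd]).
  exists (mkposreal _ Hm). intros h Hh0 Hh. simpl in Hh.
  assert (Hhr : Rabs h < r) by (eapply Rlt_le_trans; [exact Hh | apply Rmin_l]).
  assert (Hhd : Rabs (x + h - x) < d).
  { replace (x + h - x) with h by ring. eapply Rlt_le_trans; [exact Hh | apply Rmin_r]. }
  set (q := fun n => (f n (x + h) - f n x) * / h - f' n x).
  assert (Hs : Series q =
    (Series (fun n => f n (x + h)) - Series (fun n => f n x)) / h
     - Series (fun n => f' n x)).
  { unfold q. rewrite (Series_minus (fun n => (f n (x+h) - f n x) * / h)).
    - rewrite Series_scal_r, Series_minus; [reflexivity | apply Hy, Hhd | exact Hx].
    - apply ex_series_scal_r.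
      apply (ex_series_minus (fun n => f n (x + h))); [apply Hy, Hhd | exact Hx].
    - exact Hf'. }
  rewrite <- Hs.
  assert (Hq : forall n, Rabs (q n) <= 2 * M n).
  { intro n. unfold q. apply Rle_trans with (1 := Rabs_triang _ _).
    rewrite Rabs_Ropp, Rabs_mult, Rabs_inv.
    pose proof (Hi n _ Hhd) as H1. replace (x + h - x) with h in H1 by ring.
    pose proof (proj2 (Hf n x Hxx)) as H2.
    assert (H3 : 0 < Rabs h) by (apply Rabs_pos_lt; exact Hh0).
    assert (Rabs (f n (x + h) - f n x) * / Rabs h <= M n).
    { apply Rmult_le_reg_r with (Rabs h); [exact H3|].
      rewrite Rmult_assoc, Rinv_l, Rmult_1_r; lra. }
    lra. }
  pose proof (Series_tail_bound q (fun n => 2 * M n) N Hq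
                (ex_series_scal_l 2 M HM)) as Hb.
  rewrite Series_scal_l, psum_scal in Hb.
  assert (Hpq : psum q N = (psum (fun n => f n (x + h)) N - psum (fun n => f n x) N) / h
     - psum (fun n => f' n x) N).
  { unfold q. rewrite psum_minus.
    rewrite (psum_ext _ (fun n => / h * (f n (x+h) - f n x))) by (intros; ring).
    rewrite psum_scal, psum_minus. unfold Rdiv. ring. }
  specialize (Hr h Hh0 Hhr). rewrite <- Hpq in Hr. lra.
Qed.

(** * Improper Riemann sums of monotone functions *)

(** The limit is the supremum of [U y / y], as in Fekete's lemma. *)
Lemma is_lim_dilation_superadditive (U : R -> R) (K : R) :
  (forall x y, 0 < x <= y -> U x <= U y) ->
  (forall y, 0 < y -> 0 <= U y) ->
  (forall m y, (0 < m)%nat -> 0 < y -> INR m * U y <= U (INR m * y)) ->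
  (forall y, 0 < y -> U y <= K * y) ->
  exists L : R, is_lim (fun y => U y / y) p_infty L.
Proof.
  intros Hinc Hpos Hsup HK.
  destruct (completeness (fun z => exists y, 0 < y /\ z = U y / y)) as [L [HL1 HL2]].
  - exists K. intros z (y & Hy & ->). apply Rle_div_l; [exact Hy|]. apply HK, Hy.
  - exists (U 1 / 1), 1. split; [lra | reflexivity].
  - assert (Hle : forall y, 0 < y -> U y / y <= L).
    { intros y Hy. apply HL1. exists y. auto. }
    exists L.
    apply is_lim_spec. intros [eps Heps]. simpl.
    assert (Hy0 : exists y0, 0 < y0 /\ L - eps / 2 < U y0 / y0).
    { apply Classical_Prop.NNPP. intro Hn.
      assert (L <= L - eps / 2); [|lra].
      apply HL2. intros z (y & Hy & ->). apply Rnot_lt_le. intro.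
      apply Hn. exists y. auto. }
    destruct Hy0 as (y0 & Hy0 & HU0).
    exists (Rmax y0 (2 * (U y0 + 1) / eps)). intros y Hy.
    pose proof (Rmax_l y0 (2 * (U y0 + 1) / eps)).
    pose proof (Rmax_r y0 (2 * (U y0 + 1) / eps)).
    assert (Hyp : 0 < y) by lra.
    specialize (Hle y Hyp).
    (* With [m] the integer part of [y / y0], the dilation hypothesis gives [INR m * U y0 <= U y];
       rounding down costs at most [U y0], which is negligible against [y]. *)
    destruct (nfloor_ex (y / y0)) as [m [Hm1 Hm2]].
    { apply Rlt_le, Rdiv_lt_0_compat; lra. }
    assert (Hm : (0 < m)%nat).
    { destruct m; [|lia]. simpl in Hm2. exfalso.
      assert (1 <= y / y0) by (apply Rle_div_r; lra). lra. }
    apply Rle_div_r in Hm1; [|exact Hy0].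
    assert (H1 : (y / y0 - 1) * U y0 <= U y).
    { apply Rle_trans with (INR m * U y0).
      - apply Rmult_le_compat_r; [apply Hpos, Hy0 | lra].
      - apply Rle_trans with (1 := Hsup m y0 Hm Hy0). apply Hinc.
        split; [|exact Hm1]. apply Rmult_lt_0_compat; [apply lt_0_INR, Hm | exact Hy0]. }
    assert (H2 : U y0 / y0 - U y0 / y <= U y / y).
    { apply Rle_div_r; [exact Hyp|].
      replace ((U y0 / y0 - U y0 / y) * y) with ((y / y0 - 1) * U y0) by (field; lra).
      exact H1. }
    assert (H3 : U y0 / y < eps / 2).
    { apply Rlt_div_l; [exact Hyp|].
      assert (H4 : 2 * (U y0 + 1) / eps < y) by lra.
      apply Rlt_div_l in H4; lra. }
    apply Rabs_def1; lra.
Qed.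

(** The derivative of [v^d / (d (1 + v^d))]. *)
Definition bell (d v : R) : R := Rpower v (d - 1) / (1 + Rpower v d) ^ 2.

Lemma Rpower_pos x y : 0 < Rpower x y.
Proof. apply exp_pos. Qed.

Lemma bell_primitive d v : 0 < d -> 0 < v ->
  is_derive (fun v => Rpower v d / (1 + Rpower v d) / d) v (bell d v).
Proof.
  intros Hd Hv. unfold bell.
  replace (Rpower v (d - 1)) with (Rpower v d / v).
  - unfold Rpower. auto_derive.
    + pose proof (exp_pos (d * ln v)). repeat split; lra.
    + pose proof (exp_pos (d * ln v)). field. lra.
  - unfold Rminus, Rdiv. rewrite Rpower_plus, Rpower_Ropp, Rpower_1; auto.
Qed.

Section RiemannSums.

Variables (phi : R -> R) (d K : R).
Hypothesis Hd : 0 < d <= 1.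
Hypothesis phi_pos : forall v, 0 < v -> 0 <= phi v.
Hypothesis phi_decr : forall v w, 0 < v <= w -> phi w <= phi v.
Hypothesis phi_bell : forall v, 0 < v -> phi v <= K * bell d v.

Let node (y : R) (n : nat) := INR (S n) / y.
Let U (y : R) := Series (fun n => phi (node y n)).

Let node_pos y n : 0 < y -> 0 < node y n.
Proof. intro. apply Rdiv_lt_0_compat; [apply lt_0_INR; lia | assumption]. Qed.

Lemma K_nonneg : 0 <= K.
Proof.
  pose proof (phi_pos 1 Rlt_0_1). pose proof (phi_bell 1 Rlt_0_1).
  assert (0 < bell d 1).
  { apply Rdiv_lt_0_compat; [apply Rpower_pos|]. apply pow_lt.
    pose proof (Rpower_pos 1 d). lra. }
  nra.
Qed.

(** Comparison with the integral of [K * bell d]: between consecutive nodes the mean value theorem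
    expresses the increment of the primitive by [bell d c], and [phi] at the right node is at most
    [phi c]. *)
Lemma psum_nodes_le_primitive y N : 0 < y ->
  psum (fun n => phi (node y n)) (S N) <=
  y * (K * (Rpower (node y N) d / (1 + Rpower (node y N) d) / d)).
Proof.
  intro Hy. pose proof K_nonneg as HK.
  induction N as [|N IH].
  (* The interval from 0 to the first node is treated directly: [v * bell d v = p / (1 + p) ^ 2],
     and [d <= 1] gives [/ (1 + p) <= / d]. *)
  - cbn [psum]. rewrite Rplus_0_l. set (v := node y 0).
    assert (Hv : 0 < v) by apply node_pos, Hy.
    assert (Hyv : y * v = 1) by (unfold v, node; simpl; field; lra).
    apply Rle_trans with (1 := phi_bell v Hv).
    assert (E : K * bell d v = y * (K * (v * bell d v))).
    { transitivity (y * v * (K * bell d v)); [rewrite Hyv|]; ring. }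
    rewrite E. apply Rmult_le_compat_l; [lra|]. apply Rmult_le_compat_l; [exact HK|].
    unfold bell. set (p := Rpower v d).
    assert (Hp : 0 < p) by apply Rpower_pos.
    replace (v * (Rpower v (d - 1) / (1 + p) ^ 2)) with (p / (1 + p) * / (1 + p)).
    + apply Rmult_le_compat_l; [apply Rlt_le, Rdiv_lt_0_compat; lra|].
      apply Rinv_le_contravar; lra.
    + assert (v * Rpower v (d - 1) = p).
      { rewrite <- (Rpower_1 v Hv) at 1. rewrite <- Rpower_plus. unfold p. f_equal. ring. }
      rewrite <- H at 1. field. lra.
  - change (psum (fun n => phi (node y n)) (S N) + phi (node y (S N)) <=
      y * (K * (Rpower (node y (S N)) d / (1 + Rpower (node y (S N)) d) / d))).
    set (F := fun v => Rpower v d / (1 + Rpower v d) / d) in *.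
    fold (F (node y N)) in IH. fold (F (node y (S N))).
    assert (Hn : 0 < node y N) by apply node_pos, Hy.
    assert (Hnn : node y (S N) = node y N + / y).
    { unfold node. rewrite (S_INR (S N)). field. lra. }
    assert (Hiy : 0 < / y) by (apply Rinv_0_lt_compat; exact Hy).
    destruct (MVT_cor2 F (bell d) (node y N) (node y (S N))) as (c & E & Hc).
    { lra. }
    { intros c Hc. apply is_derive_Reals. apply bell_primitive; lra. }
    assert (H1 : phi (node y (S N)) <= K * bell d c).
    { apply Rle_trans with (phi c); [apply phi_decr | apply phi_bell]; lra. }
    assert (H2 : y * (F (node y (S N)) - F (node y N)) = bell d c).
    { rewrite E, Hnn. field. lra. }
    replace (y * (K * F (node y (S N))))
      with (y * (K * F (node y N)) + K * (y * (F (node y (S N)) - F (node y N)))) by ring.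
    rewrite H2. lra.
Qed.

Lemma psum_nodes_le y N : 0 < y ->
  psum (fun n => phi (node y n)) N <= K / d * y.
Proof.
  intro Hy. pose proof K_nonneg.
  (* One more term gives the nonempty sum required by [psum_nodes_le_primitive]; the primitive stays
     below [1 / d]. *)
  apply Rle_trans with (psum (fun n => phi (node y n)) (S N)).
  { apply psum_le_psum; [|lia]. intro. apply phi_pos, node_pos, Hy. }
  apply Rle_trans with (1 := psum_nodes_le_primitive y N Hy).
  pose proof (Rpower_pos (node y N) d) as Hp. set (p := Rpower (node y N) d) in *.
  replace (K / d * y) with (y * (K * (1 / d))) by (field; lra).
  apply Rmult_le_compat_l; [lra|]. apply Rmult_le_compat_l; [lra|].
  apply Rmult_le_compat_r; [apply Rlt_le, Rinv_0_lt_compat; lra|].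
  apply Rle_div_l; lra.
Qed.

Lemma ex_series_nodes y : 0 < y -> ex_series (fun n => phi (node y n)).
Proof.
  intro Hy. apply ex_series_bounded with (K / d * y).
  - intro. apply phi_pos, node_pos, Hy.
  - intro. apply psum_nodes_le, Hy.
Qed.

(** Each of the [m] consecutive nodes of [m * y] ending at [(N + 1) / y] is at
    most [(N + 1) / y]. *)
Lemma psum_nodes_dilate m y N : (0 < m)%nat -> 0 < y ->
  INR m * psum (fun n => phi (node y n)) N <=
  psum (fun n => phi (node (INR m * y) n)) (m * N).
Proof.
  intros Hm Hy. assert (HM : 0 < INR m) by (apply lt_0_INR; exact Hm).
  induction N as [|N IH].
  - rewrite Nat.mul_0_r. simpl. lra.
  - replace (m * S N)%nat with (m * N + m)%nat by lia.
    assert (H : forall j, (j <= m)%nat ->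
      psum (fun n => phi (node (INR m * y) n)) (m * N) + INR j * phi (node y N) <=
      psum (fun n => phi (node (INR m * y) n)) (m * N + j)).
    { induction j as [|j IHj]; intro Hj.
      - rewrite Nat.add_0_r. simpl. lra.
      - rewrite Nat.add_succ_r, S_INR. simpl psum.
        assert (phi (node y N) <= phi (node (INR m * y) (m * N + j))).
        { apply phi_decr. split; [apply node_pos; nra|]. unfold node.
          apply Rle_div_l; [nra|].
          replace (INR (S N) / y * (INR m * y)) with (INR (S N * m))
            by (rewrite mult_INR; field; lra).
          apply le_INR. lia. }
        specialize (IHj ltac:(lia)). lra. }
    specialize (H m (le_n _)). simpl psum at 1. lra.
Qed.

Lemma is_lim_Riemann_sums :
  exists L : R, is_lim (fun y => U y / y) p_infty L.
Proof.
  apply is_lim_dilation_superadditive with (K / d).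
  - intros x y [Hx Hxy]. apply Series_le; [|apply ex_series_nodes; lra].
    intro n. split; [apply phi_pos, node_pos, Hx|]. apply phi_decr.
    split; [apply node_pos; lra|]. unfold node.
    apply Rmult_le_compat_l; [apply pos_INR|]. apply Rinv_le_contravar; lra.
  - intros y Hy. apply Rle_trans with (psum (fun n => phi (node y n)) 0); [simpl; lra|].
    apply psum_le_Series; [intro; apply phi_pos, node_pos, Hy | apply ex_series_nodes, Hy].
  - intros m y Hm Hy. assert (HM : 0 < INR m) by (apply lt_0_INR; exact Hm).
    assert (Hmy : 0 < INR m * y) by nra.
    rewrite Rmult_comm. apply Rle_div_r; [exact HM|].
    apply Series_le_bound; [apply ex_series_nodes, Hy|]. intro N.
    apply Rle_div_r; [exact HM|]. rewrite Rmult_comm.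
    apply Rle_trans with (1 := psum_nodes_dilate m y N Hm Hy).
    apply psum_le_Series; [intro; apply phi_pos, node_pos, Hmy | apply ex_series_nodes, Hmy].
  - intros y Hy. apply Series_le_bound; [apply ex_series_nodes, Hy|].
    intro N. apply psum_nodes_le, Hy.
Qed.

End RiemannSums.

(** * Monotone profiles and their Riemann sums *)

Lemma Rpower_le_1 v x y : 0 < v <= 1 -> x <= y -> Rpower v y <= Rpower v x.
Proof.
  intros Hv Hxy. unfold Rpower.
  assert (ln v <= 0) by (rewrite <- ln_1; apply ln_le; lra).
  destruct (Rle_lt_or_eq_dec (y * ln v) (x * ln v)) as [H1|H1].
  - nra.
  - apply Rlt_le, exp_increasing, H1.
  - rewrite H1. lra.
Qed.

Lemma Rpower_le_neg v w x : 0 < v <= w -> 0 <= x -> Rpower w (- x) <= Rpower v (- x).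
Proof.
  intros Hv Hx. rewrite !Rpower_Ropp.
  apply Rinv_le_contravar; [apply Rpower_pos|]. apply Rle_Rpower_l; lra.
Qed.

Lemma Rpower_pow_mult v x n : Rpower v x ^ n = Rpower v (x * INR n).
Proof. rewrite <- Rpower_pow by apply Rpower_pos. apply Rpower_mult. Qed.

(** Increasing in [u], of order [u ^ (m + j)] at 0 and [u ^ m] at infinity. Hence
    [v |-> profile m j (v^-s)] is decreasing, and it is integrable on the half-line when
    [s * m < 1 < s * (m + j)]. *)
Definition profile (m j : nat) (u : R) : R := u ^ m * (u / (1 + u)) ^ j.

(** Equal to [u^m w^j (alpha - beta w)] with [w = u / (1 + u) < 1], hence positive for
    [0 < beta <= alpha]. It need not be monotone, so limits of its sums are taken for the two
    profiles separately. *)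
Definition combo (alpha beta : R) (m j : nat) (u : R) : R :=
  alpha * profile m j u - beta * profile m (S j) u.

Lemma ratio_bounds u : 0 < u -> 0 < u / (1 + u) < 1 /\ u / (1 + u) <= u.
Proof.
  intro Hu. repeat split.
  - apply Rdiv_lt_0_compat; lra.
  - apply Rlt_div_l; lra.
  - apply Rle_div_l; nra.
Qed.

Lemma ratio_incr u v : 0 < u <= v -> u / (1 + u) <= v / (1 + v).
Proof. intros H. apply Rle_div_l; [lra|]. rewrite Rmult_comm.
  unfold Rdiv. rewrite <- Rmult_assoc. apply Rle_div_r; nra. Qed.

Lemma profile_pos m j u : 0 < u -> 0 < profile m j u.
Proof.
  intro Hu. pose proof (ratio_bounds u Hu).
  apply Rmult_lt_0_compat; apply pow_lt; lra.
Qed.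

Lemma profile_incr m j u v : 0 < u <= v -> profile m j u <= profile m j v.
Proof.
  intro H. pose proof (ratio_bounds u ltac:(lra)). pose proof (ratio_incr u v H).
  apply Rmult_le_compat; try (apply pow_le; lra); apply pow_incr; lra.
Qed.

Lemma profile_le_pow_l m j u : 0 < u -> profile m j u <= u ^ m.
Proof.
  intro Hu. pose proof (ratio_bounds u Hu). unfold profile.
  rewrite <- (Rmult_1_r (u ^ m)) at 2. apply Rmult_le_compat_l; [apply pow_le; lra|].
  pose proof (pow_incr (u / (1 + u)) 1 j ltac:(lra)) as H1. rewrite pow1 in H1. exact H1.
Qed.

Lemma profile_le_pow_r m j u : 0 < u -> profile m j u <= u ^ (m + j).
Proof.
  intro Hu. pose proof (ratio_bounds u Hu). unfold profile.
  rewrite pow_add. apply Rmult_le_compat_l; [apply pow_le; lra|].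
  apply pow_incr. lra.
Qed.

Lemma profile_S m j u : profile m (S j) u = u / (1 + u) * profile m j u.
Proof. unfold profile. simpl. ring. Qed.

Section Profiles.

Variables (s : R) (m j : nat).
Hypothesis Hs : 0 < s.
Hypothesis Hm : s * INR m < 1.
Hypothesis Hmj : 1 < s * INR (m + j).

Let phi (v : R) : R := profile m j (Rpower v (- s)).
Let d : R := Rmin (1 - s * INR m) (s * INR (m + j) - 1).

Lemma profile_exponent : 0 < d <= 1.
Proof.
  split.
  - apply Rmin_pos; lra.
  - apply Rle_trans with (1 := Rmin_l _ _). pose proof (pos_INR m). nra.
Qed.

Lemma profile_phi_pos v : 0 < v -> 0 <= phi v.
Proof. intro. apply Rlt_le, profile_pos, Rpower_pos. Qed.

Lemma profile_phi_decr v w : 0 < v <= w -> phi w <= phi v.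
Proof.
  intro H. apply profile_incr. split; [apply Rpower_pos|].
  apply Rpower_le_neg; lra.
Qed.

(** The choice of [d] bounds [phi v] by [v^(d-1)] for [v <= 1] and by [v^(-1-d)] for [v >= 1]. The
    constant 4 arises since [(1 + p) ^ 2] is at most 4 in the first case and at most [4 p^2] in the
    second, where [p = v^d]. *)
Lemma profile_phi_bell v : 0 < v -> phi v <= 4 * bell d v.
Proof.
  intro Hv. pose proof profile_exponent as Hd.
  pose proof (Rmin_l (1 - s * INR m) (s * INR (m + j) - 1)) as Hd1.
  pose proof (Rmin_r (1 - s * INR m) (s * INR (m + j) - 1)) as Hd2.
  fold d in Hd1, Hd2. unfold phi, bell.
  pose proof (Rpower_pos v d) as Hp. pose proof (Rpower_pos v (d - 1)) as Hp1.
  set (p := Rpower v d) in *.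
  assert (Hsq : 0 < (1 + p) ^ 2) by (apply pow_lt; lra).
  destruct (Rle_dec v 1) as [Hv1|Hv1].
  - apply Rle_trans with (1 := profile_le_pow_l _ _ _ (Rpower_pos v (- s))).
    rewrite Rpower_pow_mult.
    apply Rle_trans with (Rpower v (d - 1)).
    + apply Rpower_le_1; lra.
    + assert (p <= 1).
      { unfold p. rewrite <- (Rpower_O v Hv). apply Rpower_le_1; lra. }
      apply Rmult_le_reg_r with ((1 + p) ^ 2); [exact Hsq|].
      replace (4 * (Rpower v (d - 1) / (1 + p) ^ 2) * (1 + p) ^ 2)
        with (4 * Rpower v (d - 1)) by (field; lra).
      rewrite Rmult_comm. apply Rmult_le_compat_r; nra.
  - apply Rle_trans with (1 := profile_le_pow_r _ _ _ (Rpower_pos v (- s))).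
    rewrite Rpower_pow_mult.
    apply Rle_trans with (Rpower v (- (1) - d)).
    + apply Rle_Rpower; lra.
    + assert (Hp2 : 1 <= p).
      { unfold p. rewrite <- (Rpower_O v Hv). apply Rle_Rpower; lra. }
      assert (E : Rpower v (d - 1) = Rpower v (- (1) - d) * (p * p)).
      { unfold p. rewrite <- !Rpower_plus. f_equal. ring. }
      pose proof (Rpower_pos v (- (1) - d)) as Hr.
      apply Rmult_le_reg_r with ((1 + p) ^ 2); [exact Hsq|].
      replace (4 * (Rpower v (d - 1) / (1 + p) ^ 2) * (1 + p) ^ 2)
        with (4 * Rpower v (d - 1)) by (field; lra).
      rewrite E. set (r := Rpower v (- (1) - d)) in *.
      replace (4 * (r * (p * p))) with (r * (4 * (p * p))) by ring.
      apply Rmult_le_compat_l; nra.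
Qed.

Lemma ex_series_profile_nodes y : 0 < y ->
  ex_series (fun n => profile m j (Rpower (INR (S n) / y) (- s))).
Proof.
  apply (ex_series_nodes phi d 4 profile_exponent profile_phi_pos
           profile_phi_decr profile_phi_bell).
Qed.

Lemma is_lim_profile_sums : exists L : R,
  is_lim (fun y => Series (fun n => profile m j (Rpower (INR (S n) / y) (- s))) / y)
    p_infty L.
Proof.
  exact (is_lim_Riemann_sums phi d 4 profile_exponent profile_phi_pos
           profile_phi_decr profile_phi_bell).
Qed.

End Profiles.

(** For [u <= 1] the ratio [u / (1 + u)] is at most 1/2, so the subtracted term takes away at most
    half of [beta * profile m j u]. *)
Lemma combo_lower_bound alpha beta m j q u :
  0 < beta <= alpha -> 0 < q <= u -> u <= 1 ->
  beta * (profile m j q / 2) <= combo alpha beta m j u.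
Proof.
  intros Hb Hq Hu. unfold combo. rewrite profile_S.
  pose proof (profile_incr m j q u Hq) as H1. pose proof (profile_pos m j q (proj1 Hq)) as H2.
  assert (u / (1 + u) <= / 2) by (apply Rle_div_l; lra).
  set (w := u / (1 + u)) in *. set (p := profile m j u) in *.
  assert (0 <= (alpha - beta) * p) by (apply Rmult_le_pos; lra).
  assert (beta * (w * p) <= beta * (/ 2 * p)) by
    (apply Rmult_le_compat_l; [lra | apply Rmult_le_compat_r; lra]).
  assert (beta * (profile m j q / 2) <= beta * (p / 2)) by
    (apply Rmult_le_compat_l; lra).
  lra.
Qed.

Lemma combo_pos alpha beta m j u : 0 < beta <= alpha -> 0 < u -> 0 < combo alpha beta m j u.
Proof.
  intros Hb Hu. unfold combo. rewrite profile_S.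
  pose proof (profile_pos m j u Hu). pose proof (ratio_bounds u Hu).
  set (w := u / (1 + u)) in *. set (p := profile m j u) in *.
  assert (0 < beta * ((1 - w) * p)) by (apply Rmult_lt_0_compat; [lra | apply Rmult_lt_0_compat; lra]).
  assert (0 <= (alpha - beta) * p) by (apply Rmult_le_pos; lra). lra.
Qed.

(** Only the nodes in [[1, 2]] are used for the positivity of the limit. *)
Lemma is_lim_combo_sums s m j alpha beta :
  0 < s -> s * INR m < 1 -> 1 < s * INR (m + j) -> 0 < beta <= alpha ->
  exists L : R, 0 < L /\
  is_lim (fun y => Series (fun n => combo alpha beta m j (Rpower (INR (S n) / y) (- s))) / y)
    p_infty L.
Proof.
  intros Hs Hm Hmj Hb.
  assert (Hmj' : 1 < s * INR (m + S j)).
  { rewrite Nat.add_succ_r, S_INR. nra. }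
  destruct (is_lim_profile_sums s m j Hs Hm Hmj) as [L1 HL1].
  destruct (is_lim_profile_sums s m (S j) Hs Hm Hmj') as [L2 HL2].
  assert (Hex : forall y, 0 < y ->
    ex_series (fun n => combo alpha beta m j (Rpower (INR (S n) / y) (- s)))).
  { intros y Hy. apply (ex_series_minus (fun n => alpha * profile m j _));
    apply ex_series_Rmult, ex_series_profile_nodes; assumption. }
  assert (HL : is_lim (fun y => Series (fun n =>
     combo alpha beta m j (Rpower (INR (S n) / y) (- s))) / y) p_infty
     (alpha * L1 - beta * L2)%R).
  { eapply is_lim_ext_loc; [|apply is_lim_minus'].
    2:{ apply (is_lim_scal_l _ alpha _ _ HL1). }
    2:{ apply (is_lim_scal_l _ beta _ _ HL2). }
    exists 0. intros y Hy. unfold combo.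
    rewrite (Series_minus (fun n => alpha * profile m j _) (fun n => beta * profile m (S j) _)),
      !Series_scal_l.
    - unfold Rdiv. ring.
    - apply ex_series_Rmult, ex_series_profile_nodes; assumption.
    - apply ex_series_Rmult, ex_series_profile_nodes; assumption. }
  exists (alpha * L1 - beta * L2). split; [|exact HL].
  (* The value of [v^-s] at [v = 2]; for [v] in [[1, 2]] the argument of [combo] lies in
     [[q, 1]]. *)
  set (q := Rpower 2 (- s)). set (c := beta * (profile m j q / 2)).
  assert (Hq : 0 < q) by apply Rpower_pos.
  assert (Hc : 0 < c).
  { apply Rmult_lt_0_compat; [lra|]. pose proof (profile_pos m j q Hq). lra. }
  assert (Hcu : forall u, q <= u -> u <= 1 -> c <= combo alpha beta m j u).
  { intros u Hqu Hu. apply combo_lower_bound; auto. }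
  clearbody c.
  apply Rlt_le_trans with c; [exact Hc|].
  (* The limit is read along the integers [y = N + 1]. The indices [n = N + 1 + i] with [i <= N]
     then give [N + 1] nodes in [(1, 2]], each contributing at least [c]. *)
  assert (HN : is_lim_seq (fun N => INR (S N)) p_infty)
    by (apply (is_lim_seq_incr_1 INR), is_lim_seq_INR).
  eapply (is_lim_comp_seq _ _ _ _ HL) in HN.
  2:{ exists 0%nat. intros; discriminate. }
  apply (is_lim_seq_le (fun _ => c) _ c) in HN; [exact HN | | apply is_lim_seq_const].
  intro N. set (y := INR (S N)). assert (Hy : 0 < y) by (apply lt_0_INR; lia).
  apply Rle_div_r; [exact Hy|].
  set (a := fun n => combo alpha beta m j (Rpower (INR (S n) / y) (- s))).
  assert (Ha : forall n, 0 <= a n) by (intro; apply Rlt_le, combo_pos; [lra | apply Rpower_pos]).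
  apply Rle_trans with (psum a (S N + S N)).
  2:{ apply psum_le_Series; [exact Ha | apply Hex, Hy]. }
  assert (H : forall i, (i <= S N)%nat -> c * INR i <= psum a (S N + i)).
  { induction i as [|i IH]; intro Hi.
    - rewrite Nat.add_0_r. simpl INR. rewrite Rmult_0_r.
      apply (psum_le_psum a 0 (S N) Ha). lia.
    - rewrite Nat.add_succ_r, S_INR. cbn [psum]. specialize (IH ltac:(lia)).
      assert (c <= a (S N + i)%nat); [|lra].
      apply Hcu.
      + apply Rpower_le_neg; [|lra].
        split; [apply Rdiv_lt_0_compat; [apply lt_0_INR; lia | exact Hy]|].
        apply Rle_div_l; [exact Hy|]. unfold y. rewrite <- (mult_INR 2). apply le_INR. lia.
      + apply Rle_trans with (Rpower 1 (- s)).
        * apply Rpower_le_neg; [|lra]. split; [lra|]. apply Rle_div_r; [exact Hy|].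
          rewrite Rmult_1_l. apply le_INR. lia.
        * unfold Rpower. rewrite ln_1, Rmult_0_r, exp_0. lra. }
  apply H. lia.
Qed.

(** The inverse of the modulus of the [n]-th zero of [W s], counting from [0]. *)
Definition rzero (s : R) (n : nat) : R := / Rpower (INR (S n)) s.

Lemma rzero_pos s n : 0 < rzero s n.
Proof. apply Rinv_0_lt_compat, Rpower_pos. Qed.

(** The substitution [y = x^(1/s)], under which a series in [x] over the zeros becomes a Riemann sum
    with step [1 / y]. *)
Lemma rzero_scale s x n : 0 < s -> 0 < x ->
  rzero s n * x = Rpower (INR (S n) / Rpower x (/ s)) (- s).
Proof.
  intros Hs Hx. unfold Rdiv.
  rewrite <- Rpower_mult_distr;
    [| apply lt_0_INR; lia | apply Rinv_0_lt_compat, Rpower_pos].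
  unfold rzero. rewrite Rpower_Ropp. f_equal.
  rewrite <- (Rpower_Ropp x), Rpower_mult.
  replace (- / s * - s) with 1 by (field; lra). symmetry. apply Rpower_1, Hx.
Qed.

Lemma is_lim_Rpower_p a : 0 < a -> is_lim (fun x => Rpower x a) p_infty p_infty.
Proof.
  intro Ha. unfold Rpower. apply (is_lim_comp exp _ _ _ p_infty).
  - apply is_lim_exp_p.
  - replace p_infty with (Rbar_mult a p_infty) at 2.
    + apply is_lim_scal_l, is_lim_ln_p.
    + apply is_Rbar_mult_unique, is_Rbar_mult_sym, is_Rbar_mult_p_infty_pos. exact Ha.
  - exists 0. discriminate.
Qed.

Lemma is_lim_combo_rzero s m j alpha beta :
  0 < s -> s * INR m < 1 -> 1 < s * INR (m + j) -> 0 < beta <= alpha ->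
  exists L : R, 0 < L /\
  is_lim (fun x => Series (fun n => combo alpha beta m j (rzero s n * x)) / Rpower x (/ s))
    p_infty L.
Proof.
  intros Hs Hm Hmj Hb.
  destruct (is_lim_combo_sums s m j alpha beta Hs Hm Hmj Hb) as (L & HL & Hlim).
  exists L. split; [exact HL|].
  eapply is_lim_ext_loc; [|eapply (is_lim_comp _ (fun x => Rpower x (/ s)) _ _ _ Hlim)].
  - exists 0. intros x Hx. cbv beta. f_equal. apply Series_ext. intro n.
    rewrite rzero_scale; auto.
  - apply is_lim_Rpower_p, Rinv_0_lt_compat, Hs.
  - exists 0. discriminate.
Qed.

(** Since [r = rzero s n <= 1], one has [r <= 2 r / (1 + r)], so the series is dominated by a
    multiple of the Riemann sum of [profile 0 j] with [y = 1]. *)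
Lemma ex_series_rzero_pow s j : 0 < s -> 1 < s * INR j ->
  ex_series (fun n => rzero s n ^ j).
Proof.
  intros Hs Hj.
  apply ex_series_dominated with (fun n => 2 ^ j * profile 0 j (rzero s n)).
  - intro n. pose proof (rzero_pos s n) as Hr.
    rewrite Rabs_pos_eq by (apply pow_le; lra).
    unfold profile. simpl pow at 3. rewrite Rmult_1_l, <- Rpow_mult_distr.
    apply pow_incr. split; [lra|].
    assert (rzero s n <= 1).
    { unfold rzero. rewrite <- Rinv_1. apply Rinv_le_contravar; [lra|].
      rewrite <- (Rpower_O (INR (S n))) by (apply lt_0_INR; lia).
      apply Rle_Rpower; [|lra]. apply (le_INR 1). lia. }
    set (r := rzero s n) in *.
    replace (2 * (r / (1 + r))) with (2 * r / (1 + r)) by (field; lra).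
    apply Rle_div_r; nra.
  - apply ex_series_Rmult.
    apply ex_series_ext with (fun n => profile 0 j (Rpower (INR (S n) / 1) (- s))).
    + intro n. unfold Rdiv. rewrite Rinv_1, Rmult_1_r, Rpower_Ropp. reflexivity.
    + apply ex_series_profile_nodes; simpl; lra.
Qed.

(** * The Weierstrass product on the positive half-line *)

(** The logarithm of the Weierstrass elementary factor of genus [k] at [-u]. *)
Definition logfac (k : nat) (u : R) : R :=
  ln (1 + u) + psum (fun i => (-1) ^ S i * u ^ S i / INR (S i)) k.

Definition genus (s : R) : nat := Z.to_nat (Int_part (1 / s)).

Lemma genus_bounds s : 0 < s -> s * INR (genus s) <= 1 < s * INR (S (genus s)).
Proof.
  intro Hs. pose proof (base_Int_part (1 / s)) as [H1 H2].
  assert (H : 0 < 1 / s) by (apply Rdiv_lt_0_compat; lra).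
  assert (Hz : (0 <= Int_part (1 / s))%Z).
  { apply le_IZR. assert (-1 < Int_part (1 / s))%Z; [|apply IZR_le; lia].
    apply lt_IZR. lra. }
  assert (E : INR (genus s) = IZR (Int_part (1 / s))).
  { unfold genus. rewrite INR_IZR_INZ, Znat.Z2Nat.id by exact Hz. reflexivity. }
  rewrite S_INR, E. set (z := IZR (Int_part (1 / s))) in *.
  assert (Es : s * (1 / s) = 1) by (field; lra).
  split.
  - rewrite <- Es. apply Rmult_le_compat_l; lra.
  - rewrite <- Es at 1. apply Rmult_lt_compat_l; lra.
Qed.

Lemma Cexp_RtoC x : Cexp (RtoC x) = RtoC (exp x).
Proof.
  unfold Cexp, RtoC. simpl. rewrite cos_0, sin_0. f_equal; ring.
Qed.

Lemma sum_n_m_RtoC (a : nat -> C) (b : nat -> R) k :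
  (forall j, (0 < j)%nat -> a j = RtoC (b (pred j))) ->
  sum_n_m a 1 k = RtoC (psum b k).
Proof.
  intro H. induction k as [|k IH].
  - rewrite sum_n_m_zero by lia. reflexivity.
  - rewrite sum_n_Sm by lia. rewrite IH, H by lia. simpl. rewrite RtoC_plus. reflexivity.
Qed.

Lemma weierstrass_factor_real s n x : 0 < x ->
  weierstrass_factor s (S n) (RtoC x) = RtoC (exp (logfac (genus s) (rzero s n * x))).
Proof.
  intro Hx. unfold weierstrass_factor. fold (genus s).
  pose proof (Rpower_pos (INR (S n)) s) as Hp.
  rewrite (sum_n_m_RtoC _ (fun i => (-1) ^ S i * (rzero s n * x) ^ S i / INR (S i))).
  - rewrite Cexp_RtoC, <- RtoC_div by lra. rewrite <- RtoC_plus, <- RtoC_mult.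
    f_equal. unfold logfac. rewrite exp_plus, exp_ln.
    + unfold rzero. f_equal. field. lra.
    + pose proof (rzero_pos s n). nra.
  - intros [|i] Hi; [lia|]. simpl pred.
    assert (H : 0 < INR (S i)) by (apply lt_0_INR; lia).
    rewrite <- RtoC_pow, <- RtoC_mult, <- RtoC_div.
    + f_equal. rewrite <- Rpower_pow_mult, Rpow_mult_distr. unfold rzero.
      rewrite pow_inv. field.
      split; [apply pow_nonzero|]; lra.
    + pose proof (Rpower_pos (INR (S n)) (s * INR (S i))).
      apply Rgt_not_eq, Rmult_lt_0_compat; lra.
Qed.

Lemma weierstrass_partial_real s N x : 0 < x ->
  weierstrass_partial s N (RtoC x) =
  RtoC (exp (psum (fun n => logfac (genus s) (rzero s n * x)) N)).
Proof.
  intro Hx. induction N as [|N IH]; cbn [weierstrass_partial psum].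
  - rewrite exp_0. reflexivity.
  - rewrite IH, weierstrass_factor_real, <- RtoC_mult, exp_plus by exact Hx. reflexivity.
Qed.

(** Differentiating the polynomial part cancels the first [k] terms of the geometric expansion of
    [1 / (1 + u)] and leaves its remainder. *)
Lemma is_derive_logfac k u : -1 < u ->
  is_derive (logfac k) u ((-1) ^ k * u ^ k / (1 + u)).
Proof.
  intro Hu. induction k as [|k IH].
  - apply (is_derive_ext (fun u => ln (1 + u))).
    + intro t. symmetry. apply Rplus_0_r.
    + auto_derive; [lra|]. simpl. field. lra.
  - apply (is_derive_ext
      (fun u => logfac k u + (-1) ^ S k * u ^ S k / INR (S k))).
    + intro t. apply Rplus_assoc.
    + assert (HS : INR (S k) <> 0) by (apply not_0_INR; lia).
      assert (H2 : is_derive (fun u => (-1) ^ S k * u ^ S k / INR (S k)) u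
                ((-1) ^ S k * u ^ k)).
      { auto_derive; [exact I|]. change (Nat.pred (S k)) with k.
        change (match k with 0%nat => 1 | S _ => INR k + 1 end) with (INR (S k)).
        rewrite <- tech_pow_Rmult. field. exact HS. }
      evar_last; [apply (is_derive_plus _ _ _ _ _ IH H2)|].
      change ((-1) ^ k * u ^ k / (1 + u) + (-1) ^ S k * u ^ k
              = (-1) ^ S k * u ^ S k / (1 + u)).
      simpl. field. lra.
Qed.

Lemma logfac_bound k u : 0 < u -> Rabs (logfac k u) <= u ^ S k.
Proof.
  intro Hu.
  assert (H0 : logfac k 0 = 0).
  { unfold logfac. rewrite Rplus_0_r, ln_1, (psum_ext _ (fun _ => 0 * 0)).
    - rewrite psum_scal. ring.
    - intros i _. simpl. unfold Rdiv. ring. }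
  destruct (MVT_cor2 (logfac k) (fun v => (-1) ^ k * v ^ k / (1 + v)) 0 u Hu) as (c & E & Hc).
  { intros c Hc. apply is_derive_Reals, is_derive_logfac. lra. }
  rewrite H0, !Rminus_0_r in E. rewrite E. unfold Rdiv.
  rewrite !Rabs_mult, pow_1_abs, (Rabs_pos_eq u), (Rabs_pos_eq (c ^ k)),
    Rabs_pos_eq; try lra.
  - simpl. rewrite Rmult_1_l, (Rmult_comm u). apply Rmult_le_compat_r; [lra|].
    rewrite <- (Rmult_1_r (u ^ k)). apply Rmult_le_compat.
    + apply pow_le. lra.
    + apply Rlt_le, Rinv_0_lt_compat. lra.
    + apply pow_incr. lra.
    + rewrite <- Rinv_1. apply Rinv_le_contravar; lra.
  - apply Rlt_le, Rinv_0_lt_compat. lra.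
  - apply pow_le. lra.
Qed.

(** The tails of all the series below are controlled by [rzero s n ^ (k + 1)]. *)
Lemma is_derive_Series_rzero (s : R) (f f' : R -> R) (i : nat) (A : R) x :
  0 < s -> 0 < x -> (i <= genus s)%nat ->
  (forall u, 0 < u -> is_derive f u (f' u)) ->
  (forall u, 0 < u -> Rabs (f u) <= A * u ^ (S (genus s) - i)) ->
  (forall u, 0 < u -> Rabs (f' u) <= A * u ^ (genus s - i)) ->
  is_derive (fun y => Series (fun n => rzero s n ^ i * f (rzero s n * y))) x
    (Series (fun n => rzero s n ^ S i * f' (rzero s n * x))).
Proof.
  intros Hs Hx Hi Hf Hfb Hfb'. set (k := genus s) in *.
  pose proof (genus_bounds s Hs) as Hk. fold k in Hk.
  assert (Hser : ex_series (fun n => rzero s n ^ S k)) by (apply ex_series_rzero_pow; lra).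
  assert (HA : 0 <= A).
  { specialize (Hfb 1 Rlt_0_1). rewrite pow1 in Hfb. pose proof (Rabs_pos (f 1)). lra. }
  (* On the ball of radius [x] around [x] the variable stays in [(0, 2 x)], whence the factor
     [(2 x)^(k-i)]; the powers of [rzero s n] add up to [(i + 1) + (k - i) = k + 1]. *)
  apply (is_derive_Series (fun n y => rzero s n ^ i * f (rzero s n * y))
    (fun n y => rzero s n ^ S i * f' (rzero s n * y))
    (fun n => A * (2 * x) ^ (k - i) * rzero s n ^ S k) x x Hx).
  - intros n y Hy. apply Rabs_def2 in Hy.
    pose proof (rzero_pos s n) as Hr. set (r := rzero s n) in *.
    assert (Hry : 0 < r * y) by (apply Rmult_lt_0_compat; lra).
    split.
    + evar_last.
      * apply (is_derive_scal (fun y => f (r * y))).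
        apply (is_derive_comp f (fun y => r * y)); [apply Hf, Hry|].
        apply (is_derive_scal (fun y => y)). apply is_derive_id.
      * unfold scal, one; simpl; unfold mult; simpl. ring.
    + rewrite Rabs_mult, Rabs_pos_eq by (apply pow_le; lra).
      apply Rle_trans with (r ^ S i * (A * (r * y) ^ (k - i))).
      { apply Rmult_le_compat_l; [apply pow_le; lra | apply Hfb', Hry]. }
      replace (S k) with (S i + (k - i))%nat by lia.
      rewrite pow_add, Rpow_mult_distr.
      replace (r ^ S i * (A * (r ^ (k - i) * y ^ (k - i))))
        with (A * y ^ (k - i) * (r ^ S i * r ^ (k - i))) by ring.
      apply Rmult_le_compat_r.
      { apply Rmult_le_pos; apply pow_le; lra. }
      apply Rmult_le_compat_l; [exact HA|]. apply pow_incr. lra.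
  - apply ex_series_Rmult, Hser.
  - apply ex_series_dominated with (fun n => A * x ^ (S k - i) * rzero s n ^ S k);
      [|apply ex_series_Rmult, Hser].
    intro n. pose proof (rzero_pos s n) as Hr. set (r := rzero s n) in *.
    rewrite Rabs_mult, Rabs_pos_eq by (apply pow_le; lra).
    apply Rle_trans with (r ^ i * (A * (r * x) ^ (S k - i))).
    { apply Rmult_le_compat_l; [apply pow_le; lra|]. apply Hfb, Rmult_lt_0_compat; lra. }
    right. replace (r ^ S k) with (r ^ i * r ^ (S k - i))
      by (rewrite <- pow_add; f_equal; lia).
    rewrite Rpow_mult_distr. ring.
Qed.

(** The sum of the logarithms converges and [exp] is continuous, so the total functions [Lim_seq]
    and [real] return the genuine limit of the partial products. *)
Lemma W_exp s x : 0 < s -> 0 < x ->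
  W s x = exp (Series (fun n => logfac (genus s) (rzero s n * x))).
Proof.
  intros Hs Hx.
  pose proof (genus_bounds s Hs) as Hk.
  assert (He : ex_series (fun n => logfac (genus s) (rzero s n * x))).
  { apply ex_series_dominated with (fun n => x ^ S (genus s) * rzero s n ^ S (genus s)).
    - intro n. rewrite <- Rpow_mult_distr, (Rmult_comm x). apply logfac_bound.
      apply Rmult_lt_0_compat; [apply rzero_pos | exact Hx].
    - apply ex_series_Rmult, ex_series_rzero_pow; lra. }
  unfold W, weierstrass. simpl fst. unfold Re. simpl.
  rewrite (Lim_seq_ext _ (fun N => exp (psum (fun n => logfac (genus s) (rzero s n * x)) N))).
  - rewrite (is_lim_seq_unique _ _ (is_lim_seq_continuous exp _ _
      (derivable_continuous_pt _ _ (derivable_pt_exp _)) (is_lim_seq_psum _ He))).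
    reflexivity.
  - intro N. rewrite weierstrass_partial_real by exact Hx. reflexivity.
Qed.

Lemma locally_pos x (P : R -> Prop) :
  0 < x -> (forall y, 0 < y -> P y) -> locally x P.
Proof.
  intros Hx H. exists (mkposreal x Hx). intros y Hy. apply H.
  change (Rabs (y - x) < x) in Hy. apply Rabs_def2 in Hy. lra.
Qed.

(** * The logarithmic derivative and its derivative as series over the zeros *)

Lemma x_dlogW s x : 0 < s -> 0 < x ->
  x * Derive (W s) x / W s x =
  (-1) ^ genus s * Series (fun n => profile (genus s) 1 (rzero s n * x)).
Proof.
  intros Hs Hx. set (k := genus s).
  (* [T] is the logarithm of [W s]; the factor [rzero s n ^ 0] fits it to [is_derive_Series_rzero]
     with [i = 0]. *)
  set (T := fun x => Series (fun n => rzero s n ^ 0 * logfac k (rzero s n * x))).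
  assert (HT : is_derive T x (Series (fun n => rzero s n ^ 1 *
     ((-1) ^ k * (rzero s n * x) ^ k / (1 + rzero s n * x))))).
  { apply (is_derive_Series_rzero s (logfac k) (fun u => (-1) ^ k * u ^ k / (1 + u)) 0 1);
      try assumption; try lia.
    - intros u Hu. apply is_derive_logfac. lra.
    - intros u Hu. rewrite Rmult_1_l. apply logfac_bound, Hu.
    - intros u Hu. fold k. rewrite Nat.sub_0_r, Rmult_1_l. unfold Rdiv.
      assert (0 < u ^ k) by (apply pow_lt, Hu).
      assert (0 < / (1 + u)) by (apply Rinv_0_lt_compat; lra).
      assert (/ (1 + u) <= 1) by (rewrite <- Rinv_1; apply Rinv_le_contravar; lra).
      rewrite !Rabs_mult, pow_1_abs, !Rabs_pos_eq by lra. nra. }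
  assert (HW : is_derive (W s) x (exp (T x) * Series (fun n => rzero s n ^ 1 *
     ((-1) ^ k * (rzero s n * x) ^ k / (1 + rzero s n * x))))).
  { apply (is_derive_ext_loc (fun y => exp (T y))).
    - apply locally_pos; [exact Hx|]. intros y Hy. rewrite (W_exp s y Hs Hy).
      unfold T. f_equal. apply Series_ext. intro n. apply Rmult_1_l.
    - evar_last.
      + apply (is_derive_comp exp T); [apply is_derive_Reals, derivable_pt_lim_exp | exact HT].
      + apply Rmult_comm. }
  rewrite (is_derive_unique _ _ _ HW), (W_exp s x Hs Hx).
  replace (Series (fun n => logfac (genus s) (rzero s n * x))) with (T x)
    by (apply Series_ext; intro n; simpl; apply Rmult_1_l).
  pose proof (exp_pos (T x)).
  match goal with |- x * (_ * ?S) / _ = _ => transitivity (x * S) end; [field; lra|].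
  rewrite <- !Series_scal_l. apply Series_ext. intro n.
  pose proof (rzero_pos s n). unfold profile. simpl. field. nra.
Qed.

(** The derivative of [profile k 1], that is, of [u^(k+1) / (1 + u)]. *)
Definition profile1' (k : nat) (u : R) : R :=
  u ^ k * (INR k + 1 + INR k * u) / (1 + u) ^ 2.

Lemma dxlogW_series s x : 0 < s -> 0 < x ->
  dxlogW s x =
  (-1) ^ genus s * Series (fun n => rzero s n * profile1' (genus s) (rzero s n * x)).
Proof.
  intros Hs Hx. unfold dxlogW. set (k := genus s).
  assert (H : is_derive (fun x => Series (fun n => rzero s n ^ 0 * profile k 1 (rzero s n * x)))
     x (Series (fun n => rzero s n ^ 1 * profile1' k (rzero s n * x)))).
  { apply (is_derive_Series_rzero s (profile k 1) (profile1' k) 0 (INR k + 1));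
      try assumption; try lia; fold k; rewrite ?Nat.sub_0_r; pose proof (pos_INR k) as HK.
    - intros u Hu. unfold profile, profile1'. auto_derive; [lra|].
      destruct k as [|k]; [simpl; field; lra|].
      change (Init.Nat.pred (S k)) with k. simpl pow.
      change (match k with 0%nat => 1 | S _ => INR k + 1 end) with (INR (S k)).
      field. lra.
    - intros u Hu. pose proof (profile_pos k 1 u Hu).
      pose proof (profile_le_pow_r k 1 u Hu) as H1. rewrite Nat.add_1_r in H1.
      rewrite Rabs_pos_eq by lra. assert (0 < u ^ S k) by (apply pow_lt, Hu). nra.
    - intros u Hu. unfold profile1'. assert (0 < u ^ k) by (apply pow_lt, Hu).
      assert (0 < (1 + u) ^ 2) by (apply pow_lt; lra).
      assert (0 <= INR k * u) by (apply Rmult_le_pos; lra).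
      rewrite Rabs_pos_eq.
      + apply Rle_div_l; [assumption|].
        replace ((INR k + 1) * u ^ k * (1 + u) ^ 2)
          with (u ^ k * ((INR k + 1) * (1 + u) ^ 2)) by ring.
        apply Rmult_le_compat_l; [lra|]. nra.
      + apply Rmult_le_pos; [nra|]. apply Rlt_le, Rinv_0_lt_compat. assumption. }
  transitivity ((-1) ^ k * Series (fun n => rzero s n ^ 1 * profile1' k (rzero s n * x))).
  2:{ f_equal. apply Series_ext. intro n. simpl. ring. }
  apply is_derive_unique.
  apply (is_derive_ext_loc (fun x => (-1) ^ k *
    Series (fun n => rzero s n ^ 0 * profile k 1 (rzero s n * x)))).
  - apply locally_pos; [exact Hx|]. intros y Hy. rewrite x_dlogW by assumption.
    fold k. f_equal. apply Series_ext. intro n. simpl. ring.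
  - apply (is_derive_scal (fun x =>
      Series (fun n => rzero s n ^ 0 * profile k 1 (rzero s n * x)))). exact H.
Qed.

Lemma dxlogW_combo s x : 0 < s -> 0 < x ->
  dxlogW s x = (-1) ^ genus s / x *
    Series (fun n => combo (INR (genus s) + 1) 1 (genus s) 1 (rzero s n * x)).
Proof.
  intros Hs Hx. rewrite dxlogW_series by assumption. set (k := genus s).
  unfold Rdiv. rewrite Rmult_assoc. f_equal. rewrite <- Series_scal_l.
  apply Series_ext. intro n. pose proof (rzero_pos s n).
  assert (0 < rzero s n * x) by nra.
  unfold profile1', combo, profile. simpl. field. lra.
Qed.

(** * Leading asymptotics *)

(** Here [m = k] and [j = 1]; the strict inequalities [s k < 1 < s (k + 1)] are the integrability
    conditions at 0 and at infinity. *)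
Lemma dxlogW_power_asymptotics s : 0 < s -> s * INR (genus s) < 1 ->
  exists L : R, L <> 0 /\
  is_lim (fun x => dxlogW s x * x / Rpower x (/ s)) p_infty L.
Proof.
  intros Hs H1. pose proof (genus_bounds s Hs) as Hk. set (k := genus s) in *.
  destruct (is_lim_combo_rzero s k 1 (INR k + 1) 1) as (L & HL & Hlim); try lra.
  { rewrite Nat.add_1_r. lra. }
  { pose proof (pos_INR k). lra. }
  exists ((-1) ^ k * L). split.
  - apply Rmult_integral_contrapositive. split; [apply pow_nonzero; lra | lra].
  - eapply is_lim_ext_loc; [|apply (is_lim_scal_l _ ((-1) ^ k) _ _ Hlim)].
    exists 0. intros x Hx. cbv beta. rewrite (dxlogW_combo s x) by assumption. fold k.
    pose proof (Rpower_pos x (/ s)). field. lra.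
Qed.

(** For [k > 0] this is [profile1' k u / u^(k-1)]. *)
Definition rho (k : nat) (u : R) : R := u * (INR k + 1 + INR k * u) / (1 + u) ^ 2.

Definition rho' (k : nat) (u : R) : R := ((INR k - 1) * u + (INR k + 1)) / (1 + u) ^ 3.

(** For positive genus [k], the function [F] obtained from [dxlogW s] by dividing out
    [(-1)^k x^(k-1)]. *)
Definition reduced (s x : R) : R :=
  Series (fun n => rzero s n ^ genus s * rho (genus s) (rzero s n * x)).

Lemma dxlogW_reduced s k x : 0 < s -> 0 < x -> genus s = S k ->
  dxlogW s x = (-1) ^ S k * x ^ k * reduced s x.
Proof.
  intros Hs Hx Ek. rewrite dxlogW_series by assumption. unfold reduced. rewrite Ek.
  rewrite Rmult_assoc. f_equal. rewrite <- Series_scal_l. apply Series_ext. intro n.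
  pose proof (rzero_pos s n). assert (0 < rzero s n * x) by nra.
  unfold profile1', rho. rewrite <- !tech_pow_Rmult, Rpow_mult_distr. field. lra.
Qed.

(** Differentiation removes the logarithmic divergence: [x * g x] is the sum of
    [combo (k + 2) 2 k 2] over the zeros divided by [x^(1/s)], and its exponents [k] and [k + 2] lie
    strictly on either side of [1/s = k + 1]. *)
Lemma reduced_asymptotics s k : 0 < s -> s * INR (S k) = 1 -> genus s = S k ->
  exists (L : R) (g : R -> R), 0 < L /\
  (forall x, 0 < x -> is_derive (reduced s) x (g x)) /\
  is_lim (fun x => x * g x) p_infty L.
Proof.
  intros Hs H1 Ek. rewrite S_INR in H1. pose proof (pos_INR k) as Hk0.
  destruct (is_lim_combo_rzero s k 2 (INR (S k) + 1) 2) as (L & HL & Hlim);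
    rewrite ?plus_INR, ?S_INR; simpl; try lra; try nra.
  exists L, (fun x => Series (fun n => rzero s n ^ S (S k) * rho' (S k) (rzero s n * x))).
  split; [exact HL|]. split.
  - intros x Hx. unfold reduced. rewrite Ek.
    apply (is_derive_Series_rzero s (rho (S k)) (rho' (S k)) (S k) (INR k + 2));
      try assumption; rewrite ?Ek; try lia; intros u Hu; unfold rho, rho';
      rewrite ?S_INR.
    + auto_derive; [apply Rgt_not_eq; nra|]. field. lra.
    + replace (S (S k) - S k)%nat with 1%nat by lia.
      assert (0 < (1 + u) ^ 2) by (apply pow_lt; lra).
      assert (0 <= INR k * u) by (apply Rmult_le_pos; lra).
      rewrite Rabs_pos_eq.
      * apply Rle_div_l; [assumption|].
        replace ((INR k + 2) * u ^ 1 * (1 + u) ^ 2) with (u * ((INR k + 2) * (1 + u) ^ 2)) by ring.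
        apply Rmult_le_compat_l; nra.
      * apply Rmult_le_pos; [nra|]. apply Rlt_le, Rinv_0_lt_compat. assumption.
    + rewrite Nat.sub_diag. simpl pow at 2.
      assert (0 < (1 + u) ^ 3) by (apply pow_lt; lra).
      assert (0 <= INR k * u) by (apply Rmult_le_pos; lra).
      rewrite Rabs_pos_eq.
      * apply Rle_div_l; [assumption|].
        replace ((1 + u) ^ 3) with (1 + u * (3 + 3 * u + u * u)) by ring.
        assert (0 <= u * u) by nra.
        assert (INR k * u <= (INR k + 2) * (u * (3 + 3 * u + u * u))); [|nra].
        rewrite Rmult_comm with (r1 := INR k), <- Rmult_assoc, (Rmult_comm _ u), Rmult_assoc.
        apply Rmult_le_compat_l; nra.
      * apply Rmult_le_pos; [nra|]. apply Rlt_le, Rinv_0_lt_compat. assumption.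
  - eapply is_lim_ext_loc; [|exact Hlim].
    exists 0. intros x Hx. cbv beta. unfold Rdiv.
    rewrite <- Series_scal_r, <- Series_scal_l. apply Series_ext. intro n.
    replace (/ s) with (INR (S k)) by (rewrite S_INR; field_simplify_eq; lra).
    rewrite Rpower_pow by exact Hx.
    pose proof (rzero_pos s n). assert (0 < rzero s n * x) by nra.
    assert (0 < x ^ k) by (apply pow_lt, Hx).
    unfold rho', combo, profile. rewrite <- !tech_pow_Rmult, Rpow_mult_distr, S_INR.
    simpl. field. lra.
Qed.

(** * Definability *)

Fixpoint shift (t : term) : term :=
  match t with
  | Var i => Var (S i)
  | Const r => Const r
  | Add t u => Add (shift t) (shift u)
  | Mul t u => Mul (shift t) (shift u)
  end.

Lemma eval_shift a v t : eval (scons a v) (shift t) = eval v t.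
Proof. induction t; simpl; congruence. Qed.

Fixpoint tpow (t : term) (n : nat) : term :=
  match n with O => Const 1 | S n => Mul t (tpow t n) end.

Lemma eval_tpow v t n : eval v (tpow t n) = eval v t ^ n.
Proof. induction n; simpl; congruence. Qed.

(** The language has no order symbol; over the reals, the order is expressed by the difference being
    a square. *)
Definition Le (t u : term) : formula :=
  Ex (Eq (Add (shift t) (Mul (Var 0) (Var 0))) (shift u)).

Definition Lt (t u : term) : formula := Not (Le u t).

Definition Imp (p q : formula) : formula := Or (Not p) q.

Lemma sat_Le P v t u : sat P v (Le t u) <-> eval v t <= eval v u.
Proof.
  unfold Le. cbn [sat]. split.
  - intros [a Ha]. cbn [eval] in Ha. rewrite !eval_shift in Ha. simpl in Ha. nra.
  - intro H. exists (sqrt (eval v u - eval v t)). cbn [eval]. rewrite !eval_shift.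
    simpl. rewrite sqrt_sqrt; lra.
Qed.

Lemma sat_Lt P v t u : sat P v (Lt t u) <-> eval v t < eval v u.
Proof. unfold Lt. cbn [sat]. rewrite sat_Le. lra. Qed.

Lemma sat_Imp P v p q : sat P v (Imp p q) <-> (sat P v p -> sat P v q).
Proof. unfold Imp. cbn [sat]. tauto. Qed.

(** Inside [e] and [g] the indices [0], ..., [4] stand for [f t], [f (t y)], [t],
    a lower bound for [t] and a tolerance, and [5], [6] for the two free
    variables [x], [y]. *)
Definition dilation_limit (e g : term) : formula :=
  And (Lt (Const 0) (Var 1))
   (All (Imp (Lt (Const 0) (Var 0))
    (Ex (All (Imp (Lt (Var 1) (Var 0))
     (All (All
       (Imp (Rel (Mul (Var 2) (Var 6)) (Var 1))
        (Imp (Rel (Var 2) (Var 0))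
         (Le (Mul e e) (Mul (Var 4) g))))))))))).

Definition dilation_env (f : R -> R) (x y t T eps : R) (v : nat -> R) : nat -> R :=
  scons (f t) (scons (f (t * y)) (scons t (scons T (scons eps v)))).

(** The two innermost quantified values are forced by [Rel] to be [f (t * y)] and [f t], and [Rel]
    also supplies [c < t * y] and [c < t]. *)
Lemma sat_dilation_limit c f e g v : 0 <= c ->
  sat (graph (fun x => c < x) f) v (dilation_limit e g) <->
  0 < v 1%nat /\
  forall eps, 0 < eps -> exists T, forall t, T < t -> c < t -> c < t * v 1%nat ->
    let w := dilation_env f (v 0%nat) (v 1%nat) t T eps v in
    eval w e * eval w e <= eps * eval w g.
Proof.
  intro Hc. unfold dilation_limit. cbn [sat]. rewrite sat_Lt. cbn [eval].
  apply and_iff_compat_l. split.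
  - intros H eps Heps. specialize (H eps). rewrite sat_Imp, sat_Lt in H.
    destruct (H Heps) as [T HT]. exists T. intros t Ht Hct Hcty.
    specialize (HT t). rewrite sat_Imp, sat_Lt in HT.
    specialize (HT Ht (f (t * v 1%nat)) (f t)).
    rewrite !sat_Imp, sat_Le in HT. apply HT; split; simpl; auto.
  - intros H eps. rewrite sat_Imp, sat_Lt. intro Heps.
    destruct (H eps Heps) as [T HT]. exists T. intro t. rewrite sat_Imp, sat_Lt.
    intros Ht p q. rewrite !sat_Imp, sat_Le. intros [Hp1 Hp2] [Hq1 Hq2].
    cbn in Hp1, Hp2, Hq1, Hq2. subst p q. apply HT; assumption.
Qed.

Lemma is_lim_dilate (u : R -> R) (l y : R) : 0 < y ->
  is_lim u p_infty l -> is_lim (fun t => u (t * y)) p_infty l.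
Proof.
  intros Hy Hu. apply is_lim_spec in Hu. apply is_lim_spec. intro eps.
  destruct (Hu eps) as [M HM]. exists (M / y). intros t Ht. apply HM.
  apply Rlt_div_l in Ht; assumption.
Qed.

(** Convergence of [A] to 0 in polynomial form: squaring replaces the absolute value, and comparison
    with [B], whose limit is positive, allows denominators to be cleared later. *)
Lemma square_negligible_iff (A B : R -> R) (a b c : R) :
  0 < b -> is_lim A p_infty a -> is_lim B p_infty b ->
  (forall eps, 0 < eps -> exists T, forall t, T < t -> c < t ->
     A t * A t <= eps * B t) <-> a = 0.
Proof.
  intros Hb HA HB. split.
  - intro H. apply Classical_Prop.NNPP. intro Ha.
    assert (Haa : 0 < a * a) by nra.
    (* With this tolerance the limit of the inequality reads [a * a <= a * a / 2]. *)
    set (eps := a * a / (2 * b)).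
    assert (He : 0 < eps) by (apply Rdiv_lt_0_compat; lra).
    destruct (H eps He) as [T HT].
    assert (Hle : a * a <= eps * b).
    { apply (is_lim_le_loc (fun t => A t * A t) (fun t => eps * B t) p_infty
        (a * a) (eps * b)).
      - exists (Rmax T c). intros t Ht.
        pose proof (Rmax_l T c). pose proof (Rmax_r T c). apply HT; lra.
      - apply (is_lim_mult A A p_infty a a HA HA). exact I.
      - apply (is_lim_scal_l B eps p_infty b HB). }
    unfold eps in Hle. replace (a * a / (2 * b) * b) with (a * a / 2) in Hle
      by (field; lra). lra.
  - intros -> eps Heps.
    assert (HD : is_lim (fun t => eps * B t - A t * A t) p_infty (eps * b - 0 * 0)%R).
    { apply is_lim_minus'.
      - apply (is_lim_scal_l B eps p_infty b HB).
      - apply (is_lim_mult A A p_infty 0 0 HA HA). exact I. }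
    apply is_lim_spec in HD.
    assert (Hp : 0 < eps * b) by (apply Rmult_lt_0_compat; assumption).
    destruct (HD (mkposreal _ Hp)) as [T HT]. exists T. intros t Ht _.
    specialize (HT t Ht). simpl in HT. apply Rabs_def2 in HT. lra.
Qed.

(** The nonzero weight [w] may be transcendental: [e] evaluates to [w * A] and [g] to [w^2 * B], so
    it cancels from [e * e <= eps * g], and the formula states that [A] tends to 0. *)
Lemma defines_by_dilation_limit (c : R) (f : R -> R) (Q : R -> R -> Prop)
  (e g : term) (A : R -> R -> R -> R) (B : R -> R) (w l : R -> R -> R) (b : R) :
  0 <= c -> 0 < b ->
  (forall x y t T eps v, 0 < y -> 0 < t -> v 0%nat = x -> v 1%nat = y ->
     w y t <> 0 /\
     eval (dilation_env f x y t T eps v) e = w y t * A x y t /\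
     eval (dilation_env f x y t T eps v) g = w y t * w y t * B t) ->
  (forall x y, 0 < y -> is_lim (A x y) p_infty (l x y)) ->
  is_lim B p_infty b ->
  (forall x y, Q x y <-> 0 < y /\ l x y = 0) ->
  defines (graph (fun x => c < x) f) Q.
Proof.
  intros Hc Hb Hev HA HB HQ. exists (dilation_limit e g). intro v.
  rewrite sat_dilation_limit, HQ by exact Hc.
  set (x := v 0%nat). set (y := v 1%nat).
  split; intros [Hy H]; (split; [exact Hy|]).
  (* Beyond [Rmax c (c / y)] both [t] and [t * y] exceed [c], so both values of [f] are
     available. *)
  - apply (square_negligible_iff (A x y) B (l x y) b (Rmax c (c / y))); auto.
    intros eps Heps. destruct (H eps Heps) as [T HT]. exists T. intros t Ht Hct.
    pose proof (Rmax_l c (c / y)). pose proof (Rmax_r c (c / y)).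
    assert (Ht0 : 0 < t) by lra.
    destruct (Hev x y t T eps v Hy Ht0 eq_refl eq_refl) as (Hw & E1 & E2).
    assert (H3 : c / y < t) by lra. apply Rlt_div_l in H3; [|exact Hy].
    specialize (HT t Ht ltac:(lra) H3). cbv zeta in HT. rewrite E1, E2 in HT.
    assert (Hww : 0 < w y t * w y t) by nra.
    apply Rmult_le_reg_l with (1 := Hww). lra.
  - intros eps Heps.
    destruct (proj2 (square_negligible_iff (A x y) B (l x y) b c Hb (HA x y Hy) HB)
       H eps Heps) as [T HT].
    exists T. intros t Ht Hct Hcty. cbv zeta.
    destruct (Hev x y t T eps v Hy ltac:(lra) eq_refl eq_refl) as (Hw & E1 & E2).
    rewrite E1, E2. specialize (HT t Ht Hct).
    assert (Hww : 0 < w y t * w y t) by nra.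
    replace (w y t * A x y t * (w y t * A x y t)) with (w y t * w y t * (A x y t * A x y t)) by ring.
    replace (eps * (w y t * w y t * B t)) with (w y t * w y t * (eps * B t)) by ring.
    apply Rmult_le_compat_l; lra.
Qed.

(** * Defining the power function *)

Lemma Rpower_graph_iff s x y : 0 < s ->
  graph (fun x => 0 < x) (fun x => Rpower x s) x y <-> 0 < y /\ Rpower y (/ s) = x.
Proof.
  intro Hs. unfold graph. split.
  - intros [Hx ->]. split; [apply Rpower_pos|].
    rewrite Rpower_mult, Rinv_r, Rpower_1; lra.
  - intros [Hy <-]. split; [apply Rpower_pos|].
    rewrite Rpower_mult, Rinv_l, Rpower_1; lra.
Qed.

(** With [r x = f x * x / x^(1/s)], the term [y * f (t * y) - x * f t] is [t^(1/s) / t] times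
    [r (t * y) * y^(1/s) - x * r t], whose limit [L * (y^(1/s) - x)] vanishes exactly on the graph.
    The sign of [L] is unknown, so the comparison is with the square of [f t]. *)
Lemma defines_Rpower_of_asymptotics s c f L : 0 < s -> 0 <= c -> L <> 0 ->
  is_lim (fun x => f x * x / Rpower x (/ s)) p_infty L ->
  defines (graph (fun x => c < x) f) (graph (fun x => 0 < x) (fun x => Rpower x s)).
Proof.
  intros Hs Hc HL Hlim. set (r := fun x => f x * x / Rpower x (/ s)) in *.
  apply (defines_by_dilation_limit c f _
    (Add (Mul (Var 1) (Var 6)) (Mul (Const (-1)) (Mul (Var 5) (Var 0))))
    (Mul (Var 0) (Var 0))
    (fun x y t => r (t * y) * Rpower y (/ s) - x * r t)
    (fun t => r t * r t) (fun y t => Rpower t (/ s) / t)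
    (fun x y => L * Rpower y (/ s) - x * L) (L * L)); auto.
  - nra.
  - intros x y t T eps v Hy Ht Ex Ey. unfold r. cbn. rewrite Ex, Ey.
    rewrite <- Rpower_mult_distr by assumption.
    pose proof (Rpower_pos t (/ s)). pose proof (Rpower_pos y (/ s)).
    split; [apply Rgt_not_eq, Rdiv_lt_0_compat; assumption|].
    split; field; lra.
  - intros x y Hy. apply is_lim_minus'.
    + apply (is_lim_scal_r (fun t => r (t * y)) (Rpower y (/ s)) p_infty L).
      apply is_lim_dilate; assumption.
    + apply (is_lim_scal_l r x p_infty L Hlim).
  - apply (is_lim_mult r r p_infty L L Hlim Hlim). exact I.
  - intros x y. rewrite Rpower_graph_iff by exact Hs. apply and_iff_compat_l.
    split; intro H.
    + rewrite H. ring.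
    + apply Rmult_eq_reg_l with L; lra.
Qed.

(** The graph is semialgebraic, given by [y > 0] and [y^k = x]. *)
Lemma defines_Rpower_root P s k : 0 < s -> s * INR k = 1 ->
  defines P (graph (fun x => 0 < x) (fun x => Rpower x s)).
Proof.
  intros Hs Hk. exists (And (Lt (Const 0) (Var 1)) (Eq (tpow (Var 1) k) (Var 0))).
  intro v. cbn [sat]. rewrite sat_Lt, eval_tpow, Rpower_graph_iff by exact Hs. cbn [eval].
  assert (E : / s = INR k).
  { apply Rmult_eq_reg_l with s; [|lra]. rewrite Hk. field. lra. }
  rewrite E. split; intros [Hy H]; (split; [exact Hy|]); rewrite Rpower_pow in *; assumption.
Qed.

(** * Defining the exponential function *)

(** The mean value theorem for [F - L * ln] between [t] and [t * y] gives the error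
    [(z * g z - L) * (t * (y - 1) / z)]. The first factor tends to 0 and the second is bounded
    because [z >= t * Rmin 1 y]. *)
Lemma is_lim_dilation_difference (F g : R -> R) (L y : R) : 0 < y ->
  (forall x, 0 < x -> is_derive F x (g x)) ->
  is_lim (fun x => x * g x) p_infty L ->
  is_lim (fun t => F (t * y) - F t) p_infty (L * ln y)%R.
Proof.
  intros Hy HF Hg. apply is_lim_spec in Hg. apply is_lim_spec. intros [eps Heps]. simpl.
  set (m := Rmin 1 y). assert (Hm : 0 < m) by (apply Rmin_pos; lra).
  assert (Hm1 : m <= 1) by apply Rmin_l. assert (Hmy : m <= y) by apply Rmin_r.
  (* The bound on the second factor, increased by 1 to stay positive when [y = 1]. *)
  set (D := Rabs (y - 1) / m + 1).
  assert (HD : 0 < D).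
  { assert (0 <= Rabs (y - 1) / m); [|unfold D; lra].
    apply Rmult_le_pos; [apply Rabs_pos | apply Rlt_le, Rinv_0_lt_compat, Hm]. }
  assert (Hed : 0 < eps / D) by (apply Rdiv_lt_0_compat; assumption).
  destruct (Hg (mkposreal _ Hed)) as [M HM]. simpl in HM.
  (* This puts all points between [t] and [t * y] beyond both 0 and [M]. *)
  exists (Rmax 0 M / m). intros t Ht. apply Rlt_div_l in Ht; [|exact Hm].
  pose proof (Rmax_l 0 M). pose proof (Rmax_r 0 M).
  assert (Ht0 : 0 < t) by nra.
  assert (Hlow : forall x, Rmin t (t * y) <= x -> t * m <= x).
  { intros x Hx. apply Rle_trans with (2 := Hx). apply Rmin_glb; nra. }
  destruct (MVT_gen (fun x => F x - L * ln x) t (t * y) (fun x => g x - L * / x))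
    as (z & Hz & E).
  - intros x Hx. assert (0 < x) by (pose proof (Hlow x ltac:(lra)); nra).
    apply (is_derive_minus F); [apply HF; assumption|].
    apply (is_derive_scal ln). apply is_derive_Reals, derivable_pt_lim_ln. assumption.
  - intros x Hx. assert (0 < x) by (pose proof (Hlow x ltac:(lra)); nra).
    apply continuity_pt_filterlim, (ex_derive_continuous (fun x => F x - L * ln x)).
    exists (g x - L * / x).
    apply (is_derive_minus F); [apply HF; assumption|].
    apply (is_derive_scal ln). apply is_derive_Reals, derivable_pt_lim_ln. assumption.
  - assert (Htz : t * m <= z) by (apply Hlow; lra).
    assert (Hz0 : 0 < z) by nra.
    rewrite ln_mult in E by assumption.
    replace (F (t * y) - F t - L * ln y)
      with ((z * g z - L) * (t * (y - 1) / z)).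
    2:{ transitivity ((g z - L * / z) * (t * y - t)); [field; lra | rewrite <- E; ring]. }
    rewrite Rabs_mult. specialize (HM z ltac:(lra)).
    assert (H1 : Rabs (t * (y - 1) / z) <= Rabs (y - 1) / m).
    { unfold Rdiv. rewrite !Rabs_mult, Rabs_inv, (Rabs_pos_eq t), (Rabs_pos_eq z) by lra.
      apply Rle_div_l; [exact Hz0|]. pose proof (Rabs_pos (y - 1)).
      replace (Rabs (y - 1) * / m * z) with (Rabs (y - 1) * (z / m)) by (field; lra).
      rewrite (Rmult_comm t). apply Rmult_le_compat_l; [assumption|].
      apply Rle_div_r; assumption. }
    apply Rle_lt_trans with (Rabs (z * g z - L) * (D - 1)).
    { apply Rmult_le_compat_l; [apply Rabs_pos|]. unfold D. lra. }
    assert (H2 : Rabs (z * g z - L) * D < eps) by (apply Rlt_div_r; assumption).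
    pose proof (Rabs_pos (z * g z - L)). nra.
Qed.

(** The term [f (t * y) - y^k * f t - sigma * L * x * (t * y)^k] equals [sigma * (t * y)^k] times
    [F (t * y) - F t - L * x]. The limit of the latter, [L * (ln y - x)], vanishes exactly when
    [y = exp x]. *)
Lemma defines_exp_of_asymptotics c f F g sigma k L : 0 <= c -> sigma <> 0 -> 0 < L ->
  (forall x, 0 < x -> f x = sigma * x ^ k * F x) ->
  (forall x, 0 < x -> is_derive F x (g x)) ->
  is_lim (fun x => x * g x) p_infty L ->
  defines (graph (fun x => c < x) f) (graph (fun _ => True) exp).
Proof.
  intros Hc Hsig HL Hf HF Hg.
  set (ty := Mul (Var 2) (Var 6)).
  apply (defines_by_dilation_limit c f _
    (Add (Var 1) (Add (Mul (Const (-1)) (Mul (tpow (Var 6) k) (Var 0)))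
      (Mul (Const (- (sigma * L))) (Mul (Var 5) (tpow ty k)))))
    (Mul (Const (sigma * sigma)) (Mul (tpow ty k) (tpow ty k)))
    (fun x y t => (F (t * y) - F t) - L * x)
    (fun t => 1) (fun y t => sigma * (t * y) ^ k)
    (fun x y => L * ln y - L * x) 1); auto.
  - lra.
  - intros x y t T eps v Hy Ht Ex Ey.
    assert (Hty : 0 < t * y) by (apply Rmult_lt_0_compat; assumption).
    cbn [eval]. rewrite !eval_tpow. unfold ty. cbn. rewrite Ex, Ey.
    rewrite (Hf (t * y)), (Hf t) by assumption.
    split; [|split].
    + apply Rmult_integral_contrapositive. split; [exact Hsig|]. apply pow_nonzero. lra.
    + rewrite Rpow_mult_distr. ring.
    + ring.
  - intros x y Hy. apply is_lim_minus'.
    + apply is_lim_dilation_difference with g; assumption.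
    + apply is_lim_const.
  - apply is_lim_const.
  - intros x y. unfold graph. split.
    + intros [_ ->]. split; [apply exp_pos|]. rewrite ln_exp. ring.
    + intros [Hy H]. split; [exact I|].
      assert (E : ln y = x) by (apply Rmult_eq_reg_l with L; lra).
      rewrite <- E, exp_ln; auto.
Qed.

Theorem proposition1p1 (s c : R) (hs : 0 < s) (hc : 0 <= c) :
  defines (graph (fun x => c < x) (dxlogW s))
          (graph (fun x => 0 < x) (fun x => Rpower x s)) /\
  ((exists k : nat, 1 / s = INR k) ->
   defines (graph (fun x => c < x) (dxlogW s))
           (graph (fun x => True) exp)).
Proof.
  split.
  - destruct (Rle_lt_or_eq_dec _ _ (proj1 (genus_bounds s hs))) as [H|H].
    + destruct (dxlogW_power_asymptotics s hs H) as (L & HL & Hlim).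
      apply defines_Rpower_of_asymptotics with L; assumption.
    + apply defines_Rpower_root with (genus s); assumption.
  - intros [k Hk].
    assert (E : genus s = k).
    { unfold genus. rewrite Hk, Int_part_INR. apply Znat.Nat2Z.id. }
    assert (Hsk : s * INR k = 1) by (rewrite <- Hk; field; lra).
    (* Genus 0 would give [s * 0 = 1]; writing the genus as [S k] makes the exponent of the factor
       divided out the natural number [k]. *)
    destruct k as [|k]; [simpl in Hsk; lra|].
    destruct (reduced_asymptotics s k hs Hsk E) as (L & g & HL & HF & Hg).
    apply (defines_exp_of_asymptotics c (dxlogW s) (reduced s) g ((-1) ^ S k) k L);
      try assumption.
    + apply pow_nonzero. lra.
    + intros x Hx. apply dxlogW_reduced; assumption.
Qed.
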